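(* Suppose $\mathbb{F}_0$ is compact with respect to the $L_1(\mu_0)$ metric $d(f,g)=\int|f-g|\,d\mu_0$. Then for every $\epsilon>0$ there exist $0<\alpha_0<1$ and $\delta>0$ such that $$\{f\in\mathbb{F}_0: h^\star_{\alpha_0}(f_0,f)>e^{-\delta}\}\subseteq\{f\in\mathbb{F}_0: d(f,f^\star)<\epsilon\}.$$
   Context: Let $(\mathbb{Y},\mathscr{Y},\mu)$ be a $\sigma$-finite measure space, $\mathbb{F}_0$ a family of probability densities with respect to $\mu$, and $f_0$ a probability density with respect to $\mu$, not necessarily in $\mathbb{F}_0$. $\mathsf{E}_0$ denotes expectation under $f_0$. $K(f_0,f)=\mathsf{E}_0\log(f_0/f)=\int\log(f_0/f)\,f_0\,d\mu$. There is a fixed unique $f^\star\in\mathbb{F}_0$ with $K(f_0,f^\star)=\inf_{f\in\mathbb{F}_0}K(f_0,f)$, understood to be finite. Standing assumptions: $\int(f/f^\star)f_0\,d\mu<\infty$ for all $f\in\mathbb{F}_0$, and $\int(f_0/f^\star)\,d\mu<\infty$. The measure $\mu_0$ is $d\mu_0=(f_0/f^\star)\,d\mu$, and $h^\star_\alpha(f_0,f)=\mathsf{E}_0(f/f^\star)^\alpha=\int(f/f^\star)^\alpha f_0\,d\mu$. *)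

(* Defs.v *)
From HB Require Import structures.
From mathcomp Require Import all_boot all_order all_algebra.
From mathcomp Require Import all_classical all_reals all_analysis.
From mathcomp Require Import measurable_realfun.

Set Implicit Arguments.
Unset Strict Implicit.
Unset Printing Implicit Defensive.

Import Order.TTheory GRing.Theory Num.Theory.
Import numFieldNormedType.Exports.

Local Open Scope classical_set_scope.
Local Open Scope ring_scope.
Local Open Scope ereal_scope.

Record density d (T : measurableType d) (R : realType)
    (mu : {measure set T -> \bar R}) := Density {
  density_mfun :> {mfun T >-> R} ;
  density_ge0 : forall y, (0 <= density_mfun y)%R ;
  density_int1 : \int[mu]_y (density_mfun y)%:E = 1 }.

Section density_ratio.
Context d (T : measurableType d) (R : realType).
Variable mu : {measure set T -> \bar R}.
Implicit Types f g : density mu.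

(* The quotient is taken in \bar R, where a / 0 = +oo for a > 0 and 0 / 0 = 0;
   moreover lne 0 = -oo, lne +oo = +oo and +oo * 0 = -oo * 0 = 0. *)
Definition density_ratio f g (y : T) : \bar R := (f y)%:E / (g y)%:E.

Lemma density_ratio_ge0 f g y : 0 <= density_ratio f g y.
Proof. by rewrite /density_ratio mule_ge0 ?inve_ge0 ?lee_fin ?density_ge0. Qed.

Lemma measurable_density_ratio f g : measurable_fun [set: T] (density_ratio f g).
Proof.
apply: emeasurable_funM; first exact/measurable_EFinP.
rewrite (_ : (fun y => _) =
    (fun y => if g y == 0%R then +oo else (g y `^ (-1))%R%:E)); last first.
  by apply/funext => y; rewrite inver powR_inv1 ?density_ge0.
apply: measurable_fun_ifT => //.
- exact: (measurable_fun_eqr (f := g) (g := cst 0%R)).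
- apply/measurable_EFinP.
  exact: (measurableT_comp (measurable_powR (-1)%R) (measurable_funPT g)).
Qed.

Definition kl f g : \bar R := \int[mu]_y (lne (density_ratio f g y) * (f y)%:E).

Definition hstar fstar (alpha : R) f0 f : \bar R :=
  \int[mu]_y (density_ratio f fstar y `^ alpha * (f0 y)%:E).

Definition ratio_measure f g (A : set T) : \bar R :=
  \int[mu]_(y in A) density_ratio f g y.

End density_ratio.

Section ratio_measure.
Context d (T : measurableType d) (R : realType).
Variables (mu : {measure set T -> \bar R}) (f g : density mu).

Let ratio_measure0 : ratio_measure f g set0 = 0.
Proof. exact: integral_set0. Qed.

Let ratio_measure_ge0 A : 0 <= ratio_measure f g A.
Proof. by apply: integral_ge0 => y _; exact: density_ratio_ge0. Qed.

Let ratio_measure_sigma_additive : semi_sigma_additive (ratio_measure f g).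
Proof.
apply: semi_sigma_additive_nng_induced => //.
- exact: measurable_density_ratio.
- by move=> y; exact: density_ratio_ge0.
Qed.

HB.instance Definition _ := isMeasure.Build _ _ _ (ratio_measure f g)
  ratio_measure0 ratio_measure_ge0 ratio_measure_sigma_additive.

End ratio_measure.

Definition l1dist d (T : measurableType d) (R : realType)
    (nu : {measure set T -> \bar R}) (f g : T -> R) : \bar R :=
  \int[nu]_y `|f y - g y|%:E.

(* The densities with respect to mu, topologized by the L1(nu) distance; this is
   only a pseudometric, since functions equal nu-a.e. are not identified. *)
Definition densityL1 d (T : measurableType d) (R : realType)
    (mu nu : {measure set T -> \bar R}) : Type := density mu.

Section densityL1.
Context d (T : measurableType d) (R : realType).
Variables mu nu : {measure set T -> \bar R}.
Local Notation M := (densityL1 mu nu).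

HB.instance Definition _ := gen_eqMixin M.
HB.instance Definition _ := gen_choiceMixin M.

Let ball (f : M) (e : R) : set M :=
  [set g : M | l1dist nu (f : density mu) (g : density mu) < e%:E].

Let ent : set_system (M * M) := entourage_ ball.

HB.instance Definition _ := hasNbhs.Build M (nbhs_ ent).

Let ball_center (f : M) (e : R) : (0 < e)%R -> ball f e f.
Proof.
move=> e0; rewrite /ball/= /l1dist.
under eq_integral do rewrite subrr normr0.
by rewrite integral0 lte_fin.
Qed.

Let ball_sym (f g : M) (e : R) : ball f e g -> ball g e f.
Proof.
rewrite /ball/= /l1dist => fg.
by under eq_integral do rewrite distrC.
Qed.

Let ball_triangle (f g h : M) (e1 e2 : R) :
  ball f e1 g -> ball g e2 h -> ball f (e1 + e2) h.
Proof.
rewrite /ball/= /l1dist => fg gh.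
have mD (u v : density mu) :
    measurable_fun [set: T] (fun y => `|u y - v y|%:E : \bar R).
  apply/measurable_EFinP; apply: measurableT_comp => //.
  exact: measurable_funB.
rewrite EFinD; apply: le_lt_trans (lteD fg gh).
rewrite -ge0_integralD//=.
apply: ge0_le_integral => //=; first exact: emeasurable_funD.
by move=> y _; rewrite -EFinD lee_fin ler_distD.
Qed.

HB.instance Definition _ := @Nbhs_isPseudoMetric.Build R M
  ent erefl ball ball_center ball_sym ball_triangle erefl.

Lemma ball_densityL1E (f : M) (e : R) :
  pseudometric_structure.ball f e =
  [set g : M | l1dist nu (f : density mu) (g : density mu) < e%:E].
Proof. by []. Qed.

End densityL1.

(* Main.v *)
(* Write u_f = f / fstar and M_f(a) = \int u_f^a f0 = hstar_a(f0, f).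
   If the conclusion fails for a_n = 1/(n+2), delta_n = a_n/(n+1), there are
   densities f_n in F0 at distance at least eps from fstar with
   M_{f_n}(a_n) >= 1 - delta_n. Bernoulli's inequality (1 - M_f(a)) / a <=
   (1 - M_f(b)) / b for b <= a turns this into M_{f_n}(a_N) >= 1 - 1/(n+1) for
   all N <= n, and M_f(a) is L1(mu_0)-continuous in f because
   |s^a - t^a| <= |s - t|^a. Hence a cluster point p satisfies M_p(a_N) >= 1 for
   every N. Since (u^a - 1)/a tends to ln u and is at most u - 1, Fatou's lemma
   gives \int (ln u_p) f0 >= 0, i.e. kl f0 p <= kl f0 fstar; by uniqueness
   p = fstar a.e., which contradicts the distance of f_n to p being small. *)
Require Import Defs.
From mathcomp Require Import all_boot all_order all_algebra.
From mathcomp Require Import all_classical all_reals all_analysis.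
From mathcomp Require Import measurable_realfun ring lra.

Import Order.TTheory GRing.Theory Num.Theory.
Import numFieldNormedType.Exports.

Local Open Scope classical_set_scope.
Local Open Scope ring_scope.
Local Open Scope ereal_scope.

(** * Concavity bounds for powers with exponent between 0 and 1 *)

Section power_inequalities.
Local Open Scope ring_scope.
Context {R : realType}.
Implicit Types a b e s t : R.

(** Young's inequality for the product of t^s and 1, with conjugate exponents 1/s and 1/(1-s). *)
Lemma powR_bernoulli s t : 0 <= t -> 0 < s < 1 -> t `^ s <= s * t + (1 - s).
Proof.
move=> t0 /andP[s0 s1].
have s1' : 0 < 1 - s by rewrite subr_gt0.
have := @conjugate_powR R (t `^ s) 1 s^-1 (1 - s)^-1 (powR_ge0 _ _) ler01.
rewrite !invr_gt0 !invrK subrKC powR1 mulr1 mul1r -powRrM.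
by rewrite mulfV ?gt_eqF// powRr1// (mulrC t); exact.
Qed.

(** This is [powR_bernoulli] at t/c, scaled by e, with c chosen so that c^s = e. The additive e
    absorbs the infinite slope of t^s at 0. *)
Lemma powR_le_affine s e : 0 < s < 1 -> 0 < e ->
  exists2 k, 0 < k & forall t, 0 <= t -> t `^ s <= e + k * t.
Proof.
move=> /[dup] s01 /andP[s0 s1] e0; set c := e `^ s^-1.
have c0 : 0 < c by rewrite powR_gt0.
exists (e * s / c); first by rewrite divr_gt0// mulr_gt0.
move=> t t0; have tc0 : 0 <= t / c by rewrite divr_ge0// ltW.
rewrite -[t in leLHS](divfK (lt0r_neq0 c0)) mulrC (powRM _ (ltW c0))//.
rewrite -[c `^ s]powRrM mulVf ?gt_eqF// (powRr1 (ltW e0)).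
rewrite (_ : e + _ = e * (1 + s * (t / c))); last by field; rewrite gt_eqF.
rewrite ler_pM2l//; apply: le_trans (powR_bernoulli _ _ tc0 s01) _.
by rewrite addrC lerD2r lerBlDr lerDl ltW.
Qed.

(** For 0 <= c <= a + b, the ratio c/(a+b) is at most its own s-th power. Multiply by (a+b)^s and
    add the cases c = a and c = b. *)
Lemma powR_subadditive s a b : 0 < s < 1 -> 0 <= a -> 0 <= b ->
  (a + b) `^ s <= a `^ s + b `^ s.
Proof.
move=> /andP[s0 s1] a0 b0.
have [->|ab0] := eqVneq (a + b) 0.
  by rewrite powR0 ?gt_eqF// addr_ge0 ?powR_ge0.
have {}ab0 : 0 < a + b by rewrite lt_def ab0 addr_ge0.
have ratio_le c : 0 <= c -> c <= a + b -> (a + b) `^ s * (c / (a + b)) <= c `^ s.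
  move=> c0' cab; have [->|cN0] := eqVneq c 0.
    by rewrite mul0r mulr0 powR_ge0.
  have {}c0 : 0 < c by rewrite lt_def cN0.
  rewrite -[c in leRHS](divfK (lt0r_neq0 ab0)) [in leRHS]mulrC.
  rewrite (powRM _ (ltW ab0) (divr_ge0 c0' (ltW ab0))).
  rewrite ler_pM2l ?powR_gt0// ger1_powR ?(ltW s1)//= divr_gt0//=.
  by rewrite ler_pdivrMr ?mul1r.
rewrite -[leLHS]mulr1 -(divff (lt0r_neq0 ab0)) mulrDl mulrDr.
by rewrite lerD// ratio_le ?lerDl ?lerDr.
Qed.

End power_inequalities.

(** * The extended logarithm, integration against [ratio_measure], and the logarithm as a limit of
    powers *)

Lemma measurable_lne (R : realType) : measurable_fun [set: \bar R] (@lne R).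
Proof.
rewrite (_ : @lne R = fun x => if x <= 0 then -oo
    else if x == +oo then +oo else (ln (fine x))%:E); last first.
  by apply/funext => -[r| |]//=; rewrite leNye.
apply: measurable_fun_ifT => //; first exact: measurable_fun_lee.
apply: measurable_fun_ifT => //; first exact: measurable_fun_eqe.
apply/measurable_EFinP; apply: (measurableT_comp (@measurable_ln R)).
exact: fine_measurable.
Qed.

Import HBNNSimple.
(** Monotone convergence along simple functions increasing to [h] reduces both sides to indicators,
    for which this is the definition of [ratio_measure]. *)
Lemma integral_ratio_measure d (T : measurableType d) (R : realType)
    (mu : {measure set T -> \bar R}) (f g : density mu) (h : T -> \bar R) :
  measurable_fun [set: T] h -> (forall y, 0 <= h y) ->
  \int[ratio_measure f g]_y h y = \int[mu]_y (h y * density_ratio f g y).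
Proof.
move=> mh h0; set r := density_ratio f g.
have mr : measurable_fun setT r := measurable_density_ratio f g.
have r0 y : 0 <= r y by exact: density_ratio_ge0.
pose k := nnsfun_approx measurableT mh.
have mk n : measurable_fun setT (fun y => (k n y)%:E).
  exact/measurable_EFinP.
have k_nd y : {homo (fun n => (k n y)%:E) : m n / (m <= n)%N >-> m <= n}.
  by move=> m n mn; rewrite lee_fin; exact/lefP/nd_nnsfun_approx.
have hE y : h y = limn (fun n => (k n y)%:E).
  by apply/esym/cvg_lim => //; exact: cvg_nnsfun_approx.
have hrE y : h y * r y = limn (fun n => (k n y)%:E * r y).
  have [rfin|rNfin] := boolP (r y \is a fin_num).
    apply/esym/cvg_lim => //; apply: cvgeZr => //.
    exact: cvg_nnsfun_approx.
  have -> : r y = +oo by move: rNfin; rewrite ge0_fin_numE// -leNgt leye_eq => /eqP.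
  (* Multiplication by +oo is not continuous at 0, but here the products are either eventually +oo
     or identically 0. *)
  have [[N kN0]|/forallNP kN] := pselect (exists n, (0 < k n y)%R).
    have hy0 : 0 < h y.
      apply: (@lt_le_trans _ _ (k N y)%:E); first by rewrite lte_fin.
      rewrite hE; apply: lime_ge; first exact: ereal_nondecreasing_is_cvgn.
      by exists N => // n /= Nn; exact: k_nd.
    rewrite gt0_muley//; apply/esym/cvg_lim => //; apply: cvg_near_cst.
    exists N => // n /= Nn; rewrite gt0_muley//.
    by apply: lt_le_trans (k_nd y _ _ Nn); rewrite lte_fin.
  have k0 n : k n y = 0%R.
    by apply/eqP; rewrite eq_le fun_ge0 andbT leNgt; exact/negP/kN.
  under eq_fun do rewrite k0 mul0e.
  by rewrite lim_cst// hE; under eq_fun do rewrite k0; rewrite lim_cst// mul0e.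
rewrite (eq_integral _ _ (fun y _ => hE y)) (eq_integral _ _ (fun y _ => hrE y)).
rewrite monotone_convergence//; last by move=> n y _; rewrite lee_fin.
rewrite monotone_convergence//; last 3 first.
- by move=> n; exact: emeasurable_funM.
- by move=> n y _; rewrite mule_ge0// lee_fin.
- by move=> y _ m n mn; rewrite lee_wpmul2r//; exact: k_nd.
congr (limn _); apply/funext => n.
have kE y : (k n y)%:E =
    \sum_(t \in range (k n)) (t * \1_(k n @^-1` [set t]) y)%:E.
  by rewrite fimfunE -fsumEFin.
transitivity (\int[mu]_y (\sum_(t \in range (k n))
    (t * \1_(k n @^-1` [set t]) y)%:E * r y)); last first.
  apply: eq_integral => y _; rewrite kE -ge0_mule_fsuml// => t.
  exact: nnfun_muleindic_ge0.
under eq_integral do rewrite kE.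
have mi (t : R) : measurable_fun setT
    (fun y => (t * \1_(k n @^-1` [set t]) y)%:E).
  by apply/measurable_EFinP; exact: measurable_funM.
rewrite !ge0_integral_fsum//; last 3 first.
- by move=> t; exact: emeasurable_funM.
- by move=> t y _; rewrite mule_ge0// nnfun_muleindic_ge0.
- by move=> t y _; exact: nnfun_muleindic_ge0.
(* Writing t as a value of [k n] makes its nonnegativity available. *)
apply: eq_fsbigr => t /set_mem[y _ <-].
rewrite (eq_integral _ _ (fun y' _ => EFinM _ _)) [in LHS]integralZl_indic_nnsfun//.
under [RHS]eq_integral do rewrite EFinM -muleA.
rewrite ge0_integralZl//; last 3 first.
- by apply: emeasurable_funM => //; exact/measurable_EFinP.
- by move=> z _; rewrite mule_ge0// lee_fin.
- by rewrite lee_fin.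
congr (_ * _); rewrite integral_indic// setIT [LHS]integral_mkcond.
by apply: eq_integral => z _; rewrite epatch_indic muleC.
Qed.

(** With L = ln t and x = L/(n+2), the bounds x <= e^x - 1 <= x e^x squeeze the sequence between L
    and L e^x. *)
Lemma cvg_powR_log (R : realType) (t : R) : (0 < t)%R ->
  (((t `^ n.+2%:R^-1 - 1) * n.+2%:R)%R @[n --> \oo] --> ln t).
Proof.
move=> t0; set L := ln t.
have tE n : (t `^ n.+2%:R^-1 = expR (L / n.+2%:R))%R.
  by rewrite /powR gt_eqF// mulrC.
apply: (@squeeze_cvgr _ _ _ _ (cst L) (fun n => L * expR (L / n.+2%:R))%R).
- apply: nearW => n; rewrite tE /cst.
  have n0 : (0 < n.+2%:R :> R)%R by rewrite ltr0n.
  have -> : L = (L / n.+2%:R * n.+2%:R)%R by rewrite divfK ?gt_eqF.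
  rewrite mulfK ?gt_eqF//; set x := (L / _)%R.
  rewrite [X in _ && (_ <= X)%R]mulrAC !ler_pM2r// lerBrDl expR_ge1Dx/= -subr_ge0.
  (* The upper bound is 1 - x <= e^(-x) multiplied by e^x. *)
  have -> : (x * expR x - (expR x - 1) = expR x * (expR (- x) - (1 + - x)))%R.
    by rewrite mulrBr -expRD subrr expR0; ring.
  by rewrite mulr_ge0 ?expR_ge0// subr_ge0 expR_ge1Dx.
- exact: cvg_cst.
- rewrite -[X in _ --> X]mulr1 -[X in _ --> (L * X)%R](expR0 R).
  apply: cvgM; first exact: cvg_cst.
  apply: continuous_cvg; first exact: continuous_expR.
  rewrite -[X in _ --> X](mulr0 L); apply: cvgM; first exact: cvg_cst.
  have h : ((n.+1%:R^-1 : R) @[n --> \oo] --> (0 : R))%R by exact: cvg_harmonic.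
  by rewrite -cvg_shiftS in h.
Qed.

(** * Fractional moments under a probability density [w] *)

Section weighted_moments.
Context d (T : measurableType d) (R : realType).
Variables (mu : {measure set T -> \bar R}) (w : T -> R).
Hypotheses (mw : measurable_fun [set: T] w) (w0 : forall y, (0 <= w y)%R).
Hypothesis w1 : \int[mu]_y (w y)%:E = 1.
Implicit Types u v : T -> R.

Let mM u (a : R) : measurable_fun [set: T] u ->
  measurable_fun [set: T] (fun y => (u y `^ a * w y)%:E).
Proof.
move=> um; apply/measurable_EFinP; apply: measurable_funM => //.
exact: (measurableT_comp (measurable_powR a)).
Qed.

Let mwE : measurable_fun [set: T] (EFin \o w).
Proof. exact/measurable_EFinP. Qed.

Let w0E y : 0 <= (w y)%:E.
Proof. by rewrite lee_fin. Qed.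

Let M0 u (a : R) y : 0 <= (u y `^ a * w y)%:E.
Proof. by rewrite lee_fin mulr_ge0// powR_ge0. Qed.

(** Integrates [powR_bernoulli] for u^b = (u^a)^(b/a), using that [w] has mass 1. No moment is
    subtracted, so infinite moments are allowed. *)
Lemma moment_bernoulli u (a b : R) : measurable_fun [set: T] u ->
  (0 < b < a)%R ->
  \int[mu]_y (u y `^ b * w y)%:E <=
  (b / a)%:E * (\int[mu]_y (u y `^ a * w y)%:E) + (1 - b / a)%:E.
Proof.
move=> um /andP[b0 ba]; have a0 : (0 < a)%R := lt_trans b0 ba.
have s01 : (0 < b / a < 1)%R by rewrite divr_gt0//= ltr_pdivrMr// mul1r.
have s0 : 0 <= (b / a)%:E by rewrite lee_fin; case/andP: s01 => /ltW.
have s1 : 0 <= (1 - b / a)%:E by rewrite lee_fin subr_ge0; case/andP: s01 => _ /ltW.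
rewrite -[in leRHS](mule1 (1 - b / a)%:E) -w1 -!ge0_integralZl//; last exact: mM.
rewrite -ge0_integralD//=; last 4 first.
- by move=> y _; rewrite mule_ge0.
- by apply: measurable_funeM; exact: mM.
- by move=> y _; rewrite mule_ge0.
- exact: measurable_funeM.
apply: ge0_le_integral => //=.
- exact: mM.
- by apply: emeasurable_funD; apply: measurable_funeM => //; exact: mM.
move=> y _; rewrite -!EFinM -EFinD lee_fin mulrA -mulrDl ler_wpM2r//.
rewrite -[in leLHS](divfK (lt0r_neq0 a0) b) mulrC powRrM.
by rewrite powR_bernoulli// powR_ge0.
Qed.

(** Pointwise, u^a <= (v + |u-v|)^a <= v^a + |u-v|^a <= v^a + e + k |u-v|. The constant k depends on
    a and e alone, so it can be fixed before u and v are chosen. *)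
Lemma moment_le_L1dist (a e : R) : (0 < a < 1)%R -> (0 < e)%R ->
  exists2 k : R, (0 < k)%R & forall u v,
    measurable_fun [set: T] u -> measurable_fun [set: T] v ->
    (forall y, (0 <= u y)%R) -> (forall y, (0 <= v y)%R) ->
    \int[mu]_y (u y `^ a * w y)%:E <=
    \int[mu]_y (v y `^ a * w y)%:E + e%:E +
    k%:E * \int[mu]_y (`|u y - v y| * w y)%:E.
Proof.
move=> a01 e0; have [k k0 hk] := powR_le_affine _ _ a01 e0; exists k => // u v um vm u0 v0.
have muv : measurable_fun [set: T] (fun y => (`|u y - v y| * w y)%:E).
  apply/measurable_EFinP; apply: measurable_funM => //.
  by apply: measurableT_comp => //; exact: measurable_funB.
have e0E : 0 <= e%:E by rewrite lee_fin ltW.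
have k0E : 0 <= k%:E by rewrite lee_fin ltW.
have d0 y : 0 <= (`|u y - v y| * w y)%:E by rewrite lee_fin mulr_ge0.
rewrite -[in leRHS](mule1 e%:E) -w1 -!ge0_integralZl//.
rewrite -ge0_integralD//=; last 3 first.
- exact: mM.
- by move=> y _; rewrite mule_ge0.
- exact: measurable_funeM.
rewrite -ge0_integralD//=; last 4 first.
- by move=> y _; rewrite adde_ge0// mule_ge0.
- by apply: emeasurable_funD; [exact: mM|exact: measurable_funeM].
- by move=> y _; rewrite mule_ge0.
- exact: measurable_funeM.
apply: ge0_le_integral => //=.
- exact: mM.
- apply: emeasurable_funD; last exact: measurable_funeM.
  by apply: emeasurable_funD; [exact: mM|exact: measurable_funeM].
move=> y _; rewrite -!EFinM -!EFinD lee_fin mulrA -!mulrDl ler_wpM2r// -addrA.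
apply: (@le_trans _ _ ((v y + `|u y - v y|) `^ a)%R).
  have a0 : (0 <= a)%R by case/andP: a01 => /ltW.
  apply: (ge0_ler_powR a0); rewrite ?nnegrE ?addr_ge0//.
  by rewrite addrC -lerBlDr ler_norm.
apply: le_trans (powR_subadditive _ _ _ a01 (v0 y) (normr_ge0 _)) _.
by rewrite lerD2l hk.
Qed.


(** Fatou's lemma for the nonnegative functions g_n = (u - 1 - (u^a - 1)/a) w with a = 1/(n+2). The
    moment bound gives each of them integral at most U - 1, where U is the integral of u w, and this
    bound passes to the limit (u - 1 - ln u) w. *)
Lemma moment_ge1_log_ge0 u : measurable_fun [set: T] u ->
  (forall y, (0 <= u y)%R) -> \int[mu]_y (u y * w y)%:E < +oo ->
  (forall n, 1 <= \int[mu]_y (u y `^ n.+2%:R^-1 * w y)%:E) ->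
  [/\ {ae mu, forall y, (0 < w y)%R -> (0 < u y)%R},
      mu.-integrable [set: T] (fun y => (ln (u y) * w y)%:E) &
      0 <= \int[mu]_y (ln (u y) * w y)%:E].
Proof.
move=> um u0 uw_lty M1.
have muw : measurable_fun [set: T] (fun y => (u y * w y)%:E).
  by apply/measurable_EFinP; exact: measurable_funM.
have uw0 y : 0 <= (u y * w y)%:E by rewrite lee_fin mulr_ge0.
have [U UE] : exists U : R, \int[mu]_y (u y * w y)%:E = U%:E.
  exists (fine (\int[mu]_y (u y * w y)%:E)).
  by rewrite fineK// ge0_fin_numE ?integral_ge0.
have iuw : mu.-integrable [set: T] (fun y => (u y * w y)%:E).
  apply/integrableP; split => //.
  by under eq_integral do rewrite gee0_abs//.
have iw : mu.-integrable [set: T] (fun y => (w y)%:E).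
  apply/integrableP; split => //.
  by under eq_integral do rewrite gee0_abs//; rewrite w1 ltry.
pose g n y := ((u y - 1 - (u y `^ n.+2%:R^-1 - 1) * n.+2%:R) * w y)%:E.
have mg n : measurable_fun [set: T] (g n).
  apply/measurable_EFinP; apply: measurable_funM => //.
  apply: measurable_funB; first exact: measurable_funB.
  apply: measurable_funM => //; apply: measurable_funB => //.
  exact: (measurableT_comp (measurable_powR _)).
have g0 n y : 0 <= g n y.
  rewrite lee_fin mulr_ge0// subr_ge0 -ler_pdivlMr//.
  have n01 : (0 < (n.+2%:R^-1 : R) < 1)%R.
    by rewrite invr_gt0 ltr0n/= invf_lt1 ?ltr0n// ltr1n.
  rewrite lerBlDr; apply: le_trans (powR_bernoulli _ _ (u0 y) n01) _.
  by rewrite mulrBl mul1r (mulrC (u y)) [(1 - _)%R]addrC addrA.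
have g_le n : \int[mu]_y g n y <= (U - 1)%:E.
  have n0 : 0 <= n.+2%:R%:E :> \bar R by rewrite lee_fin.
  have n1 : 0 <= n.+1%:R%:E :> \bar R by rewrite lee_fin.
  (* Stated with sums of nonnegative terms, so that additivity needs no integrability; n+1 is (n+2)
     - 1. *)
  have : \int[mu]_y g n y + n.+2%:R%:E * \int[mu]_y (u y `^ n.+2%:R^-1 * w y)%:E =
      U%:E + n.+1%:R%:E.
    rewrite -UE -[X in _ + X = _]ge0_integralZl//; last exact: mM.
    rewrite -[in RHS](mule1 n.+1%:R%:E) -w1 -[in RHS]ge0_integralZl//.
    rewrite -!ge0_integralD//; last 4 first.
    - by move=> y _; rewrite mule_ge0.
    - exact: measurable_funeM.
    - by move=> y _; rewrite mule_ge0.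
    - by apply: measurable_funeM; exact: mM.
    apply: eq_integral => y _; rewrite -!EFinM -!EFinD; congr EFin.
    by rewrite -(natr1 n.+1); ring.
  move=> gE; have : \int[mu]_y g n y + n.+2%:R%:E <= U%:E + n.+1%:R%:E.
    rewrite -gE; apply: leeD2l; rewrite -[leLHS]mule1.
    by apply: lee_wpmul2l => //; exact: M1.
  case: (\int[mu]_y g n y) => [r| |].
  - by rewrite -!EFinD !lee_fin -(natr1 n.+1); lra.
  - by rewrite leye_eq.
  - by move=> _; exact: leNye.
pose h y := ((u y - 1 - ln (u y)) * w y)%R.
have mh : measurable_fun [set: T] h.
  apply: measurable_funM => //; apply: measurable_funB; first exact: measurable_funB.
  exact: (measurableT_comp (@measurable_ln R)).
(* G corrects h where u vanishes: there (u^a - 1)/a tends to -oo, while ln 0 = 0. *)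
pose G y := if (0 < w y)%R && (u y == 0%R) then +oo else (h y)%:E.
have GE y : limn_einf (g ^~ y) = G y.
  have [wy|wy] := eqVneq (w y) 0%R.
    rewrite /G wy ltxx/= /h wy mulr0 (_ : g ^~ y = cst 0) ?funeqE.
      by rewrite (cvg_limn_einf_sup (@cvg_cst _ _ _ _ _)).
    by move=> n; rewrite /g wy mulr0.
  have {}wy : (0 < w y)%R by rewrite lt_def wy w0.
  rewrite /G wy/=; have [uy|uy] := eqVneq (u y) 0%R.
    (* At u = 0 the term equals (n+1) w, which is unbounded since w > 0. *)
    suff: g n y @[n --> \oo] --> +oo by move/cvg_limn_einf_sup => ->.
    apply/cvgeryP/cvgryPge => A; near=> n.
    rewrite uy powR0 ?invr_eq0// -ler_pdivrMr//.
    rewrite (_ : (_ - _ = n.+1%:R)%R); last by rewrite -(natr1 n.+1); ring.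
    apply: (@le_trans _ _ n%:R); last by rewrite ler_nat.
    by near: n; exact: nbhs_infty_ger.
  have {}uy : (0 < u y)%R by rewrite lt_def uy u0.
  suff: g n y @[n --> \oo] --> (h y)%:E by move/cvg_limn_einf_sup => ->.
  apply: cvg_EFin; first exact: nearW.
  apply: cvgM; last exact: cvg_cst.
  by apply: cvgB; [exact: cvg_cst|exact: cvg_powR_log].
have mG : measurable_fun [set: T] G.
  apply: measurable_fun_ifT => //; last exact/measurable_EFinP.
  apply: measurable_and; first exact: measurable_fun_ltr.
  exact: measurable_fun_eqr.
have G0 y : 0 <= G y.
  rewrite -GE limn_einf_lim; apply: lime_ge; first exact: is_cvg_einfs.
  by apply: nearW => n; apply: le_ereal_inf_tmp => _ [m /= _ <-].
have G_le : \int[mu]_y G y <= (U - 1)%:E.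
  under eq_integral do rewrite -GE.
  apply: le_trans (fatou _ _ _ _) _ => //.
  rewrite limn_einf_lim; apply: lime_le; first exact: is_cvg_einfs.
  apply: nearW => n; apply: le_trans (g_le n).
  by apply: ereal_inf_lbound; exists n => /=.
have iG : mu.-integrable [set: T] G.
  apply/integrableP; split => //.
  under eq_integral do rewrite gee0_abs//.
  by apply: le_lt_trans G_le _; rewrite ltry.
have ih : mu.-integrable [set: T] (EFin \o h).
  apply: le_integrable iG => //; first exact/measurable_EFinP.
  by move=> y _; rewrite /G; case: ifP => //= _; rewrite leey.
(* [G] is integrable, hence finite almost everywhere, and it is +oo where w > 0 and u = 0. *)
have aeu : {ae mu, forall y, (0 < w y)%R -> (0 < u y)%R}.
  have := integrable_ae measurableT iG; apply: filterS => y /(_ Logic.I).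
  rewrite /G => + wy; rewrite wy/=; case: eqVneq => // uy _.
  by rewrite lt_def uy u0.
have hG : \int[mu]_y (h y)%:E = \int[mu]_y G y.
  apply: ae_eq_integral => //; first exact/measurable_EFinP.
  move: aeu; apply: filterS => y wu _; rewrite /G; case: ifPn => // /andP[/wu + /eqP uy].
  by rewrite uy ltxx.
(* All three terms are integrable, so the integral of (ln u) w is U - 1 minus that of [G], hence
   nonnegative by [G_le]. *)
have lE : (fun y => (ln (u y) * w y)%:E) =
    ((fun y => (u y * w y)%:E) \- (fun y => (w y)%:E)) \- (EFin \o h).
  by apply/funext => y; rewrite /= -!EFinB /h; congr EFin; ring.
have iuww := integrableB measurableT iuw iw.
split => //; first by rewrite lE; exact: integrableB.
rewrite lE integralB// integralB// UE w1 hG.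
have : 0 <= \int[mu]_y G y by exact: integral_ge0.
move: G_le; case: (\int[mu]_y G y) => [r| |].
- by rewrite -!EFinB !lee_fin subr_ge0.
- by rewrite leye_eq.
- by move=> _; rewrite leeNy_eq.
Unshelve. all: by end_near. Qed.

End weighted_moments.

(** The integral is the difference of those of the positive and negative parts, and a difference in
    \bar R is finite only if both terms are. *)
Lemma integral_fin_num_integrable d (T : measurableType d) (R : realType)
    (mu : {measure set T -> \bar R}) (h : T -> \bar R) :
  measurable_fun [set: T] h -> \int[mu]_y h y \is a fin_num ->
  mu.-integrable [set: T] h.
Proof.
move=> mh; rewrite integralE fin_numB => /andP[hp hn].
apply/integrableP; split => //.
under eq_integral do rewrite -/((abse \o h) _) fune_abse.
rewrite ge0_integralD//; last 2 first.
- exact: measurable_funepos.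
- exact: measurable_funeneg.
by rewrite lte_add_pinfty// ltey_eq ?hp ?hn.
Qed.

(** * Passage from quotients in \bar R to real quotients *)

Section density_ratio_real.
Context d (T : measurableType d) (R : realType).
Variables (mu : {measure set T -> \bar R}) (f0 fstar : density mu).
Hypothesis f0_int : \int[mu]_y density_ratio f0 fstar y < +oo.
Implicit Types f g h : density mu.

Local Notation u f := (fun y => (f y / fstar y)%R).

Lemma density_ratio_EFin f y : fstar y != 0%R ->
  density_ratio f fstar y = (u f y)%:E.
Proof. by move=> fy0; rewrite /density_ratio inver (negbTE fy0) -EFinM. Qed.

(** An integrable f0/fstar is finite almost everywhere, whereas it is +oo where f0 > 0 and fstar =
    0. *)
Lemma ae_fstar_neq0 : {ae mu, forall y, f0 y != 0%R -> fstar y != 0%R}.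
Proof.
have := @integrable_ae _ _ _ mu setT measurableT (density_ratio f0 fstar).
have -> : mu.-integrable [set: T] (density_ratio f0 fstar).
  apply/integrableP; split; first exact: measurable_density_ratio.
  by under eq_integral do rewrite gee0_abs ?density_ratio_ge0//.
move=> /(_ isT); apply: filterS => y /(_ Logic.I) + f0y; apply: contraTneq => fy.
rewrite /density_ratio inver fy eqxx gt0_muley//.
by rewrite lte_fin lt_def f0y density_ge0.
Qed.

Lemma measurable_quot f : measurable_fun [set: T] (u f).
Proof.
apply: measurable_funM => //.
rewrite (_ : (fun y => _) = (fun y => fstar y `^ (-1))%R).
  exact: (measurableT_comp (measurable_powR (-1)%R)).
by apply/funext => y; rewrite powR_inv1 ?density_ge0.
Qed.

Lemma quot_ge0 f y : (0 <= u f y)%R.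
Proof. by rewrite divr_ge0 ?density_ge0. Qed.

Let quot_powR_measurable f (a : R) :
  measurable_fun [set: T] (fun y => (u f y `^ a * f0 y)%:E).
Proof.
apply/measurable_EFinP; apply: measurable_funM => //.
exact: (measurableT_comp (measurable_powR a) (measurable_quot f)).
Qed.

(** The real and extended quotients can differ only where fstar = 0; there f0 = 0 almost everywhere,
    so the weight removes the difference. *)
Lemma hstarE f (a : R) :
  hstar fstar a f0 f = \int[mu]_y (u f y `^ a * f0 y)%:E.
Proof.
apply: ge0_ae_eq_integral => //.
- apply: emeasurable_funM; last exact/measurable_EFinP.
  exact: (measurableT_comp (measurable_poweR a) (measurable_density_ratio _ _)).
- by move=> y _; rewrite mule_ge0 ?poweR_ge0// lee_fin density_ge0.
- by move=> y _; rewrite lee_fin mulr_ge0 ?powR_ge0 ?density_ge0.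
move: ae_fstar_neq0; apply: filterS => y fy _.
have [->|/fy fy0] := eqVneq (f0 y) 0%R; first by rewrite mule0 mulr0.
by rewrite density_ratio_EFin// poweR_EFin.
Qed.

Lemma integral_density_ratioM f :
  \int[mu]_y (density_ratio f fstar y * (f0 y)%:E) =
  \int[mu]_y (u f y * f0 y)%:E.
Proof.
have := hstarE f 1; rewrite /hstar.
under eq_integral do rewrite poweRe1 ?density_ratio_ge0//.
by under [X in _ = X -> _]eq_integral do rewrite powRr1 ?quot_ge0//.
Qed.

(** Brings the distance into the form of the error term in [moment_le_L1dist]. *)
Lemma l1dist_ratio_measureE f g :
  l1dist (ratio_measure f0 fstar) f g =
  \int[mu]_y (`|u f y - u g y| * f0 y)%:E.
Proof.
have mfg : measurable_fun [set: T] (fun y => `|f y - g y|%:E : \bar R).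
  by apply/measurable_EFinP; apply: measurableT_comp => //; exact: measurable_funB.
rewrite /l1dist integral_ratio_measure//.
apply: ge0_ae_eq_integral => //.
- by apply: emeasurable_funM => //; exact: measurable_density_ratio.
- apply/measurable_EFinP; apply: measurable_funM => //.
  by apply: measurableT_comp => //; apply: measurable_funB; exact: measurable_quot.
- by move=> y _; rewrite mule_ge0 ?density_ratio_ge0.
- by move=> y _; rewrite lee_fin mulr_ge0 ?density_ge0.
move: ae_fstar_neq0; apply: filterS => y fy _.
have [f0y|/fy fy0] := eqVneq (f0 y) 0%R.
  by rewrite /density_ratio f0y mul0e mule0 mulr0.
rewrite density_ratio_EFin// -EFinM; congr EFin.
rewrite -mulrBl normrM [X in (_ * X * _)%R]ger0_norm ?invr_ge0 ?density_ge0//.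
by rewrite mulrA mulrAC.
Qed.

Lemma l1dist_ae_eq f g h : {ae mu, forall y, f y = g y} ->
  l1dist (ratio_measure f0 fstar) f h = l1dist (ratio_measure f0 fstar) g h.
Proof.
move=> fg; rewrite !l1dist_ratio_measureE; apply: ge0_ae_eq_integral => //.
1,2: apply/measurable_EFinP; apply: measurable_funM => //.
1,2: by apply: measurableT_comp => //; apply: measurable_funB; exact: measurable_quot.
1,2: by move=> y _; rewrite lee_fin mulr_ge0 ?density_ge0.
by move: fg; apply: filterS => y ->.
Qed.

Let kl_integrand_measurable f :
  measurable_fun [set: T] (fun y => lne (density_ratio f0 f y) * (f0 y)%:E).
Proof.
apply: emeasurable_funM; last exact/measurable_EFinP.
exact: (measurableT_comp (measurable_lne R) (measurable_density_ratio _ _)).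
Qed.

(** Where f0 > 0, log(f0/f) = log(f0/fstar) - log(f/fstar). Finiteness of [kl f0 fstar] makes the
    first term integrable, so the integral splits. *)
Lemma kl_le_of_log_quot f : kl f0 fstar \is a fin_num ->
  {ae mu, forall y, (0 < f0 y)%R -> (0 < u f y)%R} ->
  mu.-integrable [set: T] (fun y => (ln (u f y) * f0 y)%:E) ->
  0 <= \int[mu]_y (ln (u f y) * f0 y)%:E ->
  kl f0 f <= kl f0 fstar.
Proof.
move=> klfin fpos il il0.
pose k y := lne (density_ratio f0 fstar y) * (f0 y)%:E.
have ik : mu.-integrable [set: T] k by apply: integral_fin_num_integrable => //; exact: kl_integrand_measurable.
have -> : kl f0 f = \int[mu]_y (k y - (ln (u f y) * f0 y)%:E).
  apply: ae_eq_integral => //.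
    exact: measurable_int (integrableB measurableT ik il).
  move: fpos ae_fstar_neq0; apply: filterS2 => y upos fy _.
  have [f0y|f0y] := eqVneq (f0 y) 0%R; first by rewrite /k f0y mulr0 !mule0 sube0.
  have {}f0y : (0 < f0 y)%R by rewrite lt_def f0y density_ge0.
  have {fy}sy : (0 < fstar y)%R by rewrite lt_def fy ?gt_eqF// density_ge0.
  have {upos}fy : (0 < f y)%R.
    by have := upos f0y; rewrite pmulr_lgt0// invr_gt0.
  rewrite /k density_ratio_EFin ?gt_eqF// /density_ratio inver gt_eqF// -EFinM.
  rewrite !lne_EFin ?divr_gt0// -!EFinM -EFinB -mulrBl; congr (_ * _)%:E.
  rewrite !ln_div ?posrE//; ring.
rewrite integralB// leeBlDr// ?leeDl//.
exact: integrable_fin_num il.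
Qed.

End density_ratio_real.

(** * Bad sequence, cluster point and contradiction *)

Theorem theorem7 (d : measure_display) (Y : measurableType d) (R : realType)
    (mu : {sigma_finite_measure set Y -> \bar R})
    (F0 : set (density mu)) (f0 fstar : density mu)
    (fstar_in : F0 fstar)
    (fstar_min : kl f0 fstar = ereal_inf [set kl f0 f | f in F0])
    (fstar_fin : kl f0 fstar \is a fin_num)
    (fstar_unique : forall f : density mu, F0 f ->
      kl f0 f = ereal_inf [set kl f0 g | g in F0] ->
      {ae mu, forall y, f y = fstar y})
    (f_int : forall f : density mu, F0 f ->
      \int[mu]_y (density_ratio f fstar y * (f0 y)%:E) < +oo)
    (f0_int : \int[mu]_y density_ratio f0 fstar y < +oo)
    (F0_compact : compact (F0 : set (densityL1 mu (ratio_measure f0 fstar))))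
    (eps : R) (eps_gt0 : (0 < eps)%R) :
  exists (alpha0 delta : R),
    [/\ (0 < alpha0 < 1)%R, (0 < delta)%R &
      [set f | F0 f /\ (expR (- delta))%:E < hstar fstar alpha0 f0 f] `<=`
      [set f | F0 f /\ l1dist (ratio_measure f0 fstar) f fstar < eps%:E]].
Proof.
pose a n : R := (n.+2%:R^-1)%R.
have a01 n : (0 < a n < 1)%R.
  by rewrite /a invr_gt0 ltr0n/= invf_lt1 ?ltr0n// ltr1n.
have a0 n : (0 < a n)%R by case/andP: (a01 n).
apply: contrapT => noP.
(* Negation at delta = a_n/(n+1), with e^(-delta) >= 1 - delta. The extra factor 1/(n+1) keeps the
   defect of the moment small after division by a_n. *)
have /choice[s sP] n : exists f : density mu,
    [/\ F0 f, (1 - a n / n.+1%:R)%:E <= hstar fstar (a n) f0 f &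
        eps%:E <= l1dist (ratio_measure f0 fstar) f fstar].
  have : exists f : density mu,
     (F0 f /\ (expR (- (a n / n.+1%:R)))%:E < hstar fstar (a n) f0 f) /\
     ~ (F0 f /\ l1dist (ratio_measure f0 fstar) f fstar < eps%:E).
    apply: contrapT => /forallNP nof; apply: noP.
    exists (a n), (a n / n.+1%:R)%R; split => //; first exact: divr_gt0.
    by move=> f Ff; apply: contrapT => fN; apply: (nof f).
  move=> [f [[Ff hf] fN]]; exists f; split => //.
    by apply: le_trans (ltW hf); rewrite lee_fin expR_ge1Dx.
  by rewrite leNgt; apply/negP => ?; exact: fN.
pose M := densityL1 mu (ratio_measure f0 fstar).
have [p [F0p clp]] : (F0 : set M) `&` cluster ((s : nat -> M) @ \oo) !=set0.
  by apply: F0_compact; exists 0%N => // n _; have [] := sP n.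
(* Clustering yields arbitrarily late terms near [p], so no subsequence has to be fixed. *)
have s_close (e : R) N : (0 < e)%R -> exists2 n, (N <= n)%N &
    l1dist (ratio_measure f0 fstar) (p : density mu) (s n) < e%:E.
  move=> e0.
  have sN : (s @ \oo) [set s n | n in [set n | (N <= n)%N]].
    by exists N => // n Nn; exists n.
  have [_ [[n Nn <-]]] := clp _ _ sN (nbhsx_ballx p _ e0).
  by rewrite ball_densityL1E => /= ?; exists n.
pose u (f : density mu) y := (f y / fstar y)%R.
have f0m : measurable_fun setT f0 by [].
have f0ge y : (0 <= f0 y)%R by exact: density_ge0.
have um (f : density mu) : measurable_fun setT (u f) by exact: measurable_quot.
have uge (f : density mu) y : (0 <= u f y)%R by exact: quot_ge0.
have s_moment N n : (N <= n)%N ->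
    (1 - n.+1%:R^-1)%:E <= \int[mu]_y (u (s n) y `^ a N * f0 y)%:E.
  move=> Nn; have [_ + _] := sP n; rewrite hstarE// => sn.
  (* [moment_bernoulli] needs distinct exponents, so N = n is treated apart. *)
  have [->|nN] := eqVneq N n.
    apply: le_trans sn; rewrite lee_fin lerD2l lerN2 ler_piMl// ltW//.
    by case/andP: (a01 n).
  have anN : (0 < a n < a N)%R.
    rewrite a0/= /a ltf_pV2 ?posrE// ltr_nat !ltnS.
    by rewrite ltn_neqAle nN.
  have := le_trans sn (@moment_bernoulli _ _ _ mu f0 f0m f0ge (density_int1 f0) _ _ _ (um (s n)) anN).
  case: (\int[mu]_y _) => [r| |].
  - rewrite -EFinM -EFinD !lee_fin => h.
    have : (a n / a N * (1 - r) <= a n / n.+1%:R)%R.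
      by move: h; rewrite mulrBr mulr1; set q := (a n / a N)%R; set t := (q * r)%R;
        set b := (a n / _)%R; lra.
    rewrite -mulrA ler_pM2l// ler_pdivrMl// => h'.
    have : (a N / n.+1%:R <= n.+1%:R^-1)%R.
      by rewrite ler_piMl// ltW//; case/andP: (a01 N).
    by move=> /(le_trans h'); rewrite !lerBlDr addrC.
  - by rewrite leey.
  - by rewrite gt0_muleNy ?lte_fin ?divr_gt0// addNye leeNy_eq.
have p_moment N : 1 <= \int[mu]_y (u p y `^ a N * f0 y)%:E.
  (* The error e is split into three: the defect 1/(n+1), the additive constant of
     [moment_le_L1dist], and k times a distance below e/(3k). *)
  apply/lee_addgt0Pr => e e0; have e3 : (0 < e / 3)%R by rewrite divr_gt0.
  have [k k0 hk] := @moment_le_L1dist _ _ _ mu f0 f0m f0ge (density_int1 f0) _ _ (a01 N) e3.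
  have [N' N'e] : exists N', (N'.+1%:R^-1 < e / 3)%R.
    have [N' _ /(_ N' (leqnn _))] := near_infty_natSinv_lt (PosNum e3).
    by exists N'.
  have [n] := s_close (e / 3 / k)%R (maxn N N') (divr_gt0 e3 k0).
  rewrite geq_max => /andP[Nn N'n] pn.
  have {N'e}ne : (n.+1%:R^-1 <= e / 3)%R.
    by apply: le_trans (ltW N'e); rewrite lef_pV2 ?posrE// ler_nat.
  have := le_trans (s_moment N n Nn) (hk _ _ (um (s n)) (um p) (uge (s n)) (uge p)).
  under [X in _ + k%:E * X]eq_integral do rewrite distrC.
  rewrite -l1dist_ratio_measureE// => h.
  have : (1 - n.+1%:R^-1)%:E <=
      \int[mu]_y (u p y `^ a N * f0 y)%:E + (e / 3)%:E + (e / 3)%:E.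
    apply: le_trans h _; apply: leeD2l.
    rewrite -[(e / 3)%R](divfK (lt0r_neq0 k0)) mulrC EFinM.
    by apply: lee_wpmul2l (ltW pn); rewrite lee_fin ltW.
  case: (\int[mu]_y _) => [r| |].
  - by rewrite -!EFinD !lee_fin; move: ne; set i := (n.+1%:R^-1)%R; lra.
  - by move=> _; rewrite addye// leey.
  - by rewrite !addNye leeNy_eq.
have up_int : \int[mu]_y (u p y * f0 y)%:E < +oo.
  by rewrite -integral_density_ratioM//; exact: f_int.
have [p_pos lnp_int lnp_ge0] := @moment_ge1_log_ge0 _ _ _ mu f0 f0m f0ge
  (density_int1 f0) _ (um p) (uge p) up_int p_moment.
have klp : kl f0 p = ereal_inf [set kl f0 g | g in F0].
  apply/eqP; rewrite eq_le -{1}fstar_min kl_le_of_log_quot//=.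
  by apply: ereal_inf_lbound; exists p.
have [n _] := s_close eps 0%N eps_gt0.
(* [p] and [fstar] agree only almost everywhere, which suffices to move the distance from [p] to
   [fstar]. *)
rewrite (@l1dist_ae_eq _ _ _ mu _ _ f0_int p fstar (s n) (fstar_unique _ F0p klp)).
have [_ _] := sP n.
by rewrite /l1dist; under eq_integral do rewrite distrC; rewrite leNgt => /negP.
Qed.
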